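(* Let $P_k$ and $Q_k$ be the Rudin-Shapiro polynomials of degree $n-1$ with $n:=2^k$, and let either $R_k(t):=|P_k(e^{it})|^2$ or $R_k(t):=|Q_k(e^{it})|^2$. There is an absolute constant $A>0$ such that the equation $R_k(t)=(1+\eta)n$ has at least $A\,n^{0.36}$ distinct solutions in $K$ whenever $\eta$ is real and $|\eta|<2^{-11}$.
   Context: The Rudin-Shapiro polynomials are defined recursively by $P_0(z):=1$, $Q_0(z):=1$, and $$P_{k+1}(z):=P_k(z)+z^{2^k}Q_k(z),\qquad Q_{k+1}(z):=P_k(z)-z^{2^k}Q_k(z),\qquad k=0,1,2,\ldots.$$ Both $P_k$ and $Q_k$ are polynomials of degree $n-1$ with $n:=2^k$. $K:=\mathbb{R}\ (\mathrm{mod}\ 2\pi)$.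
   Formalization: The theorem is stated for k ≥ 1: at k = 0 one has P_0 = Q_0 = 1, n = 1 and R_0 identically 1, so R_0(t) = 1 + η has no solution for η ≠ 0 and the claim fails. *)

(* Defs.v *)
From mathcomp Require Import all_boot all_order all_algebra.
From mathcomp Require Import complex.
From mathcomp Require Import all_classical all_reals all_analysis.

Set Implicit Arguments.
Unset Strict Implicit.
Unset Printing Implicit Defensive.

Import Order.TTheory GRing.Theory Num.Theory.

Local Open Scope ring_scope.
Local Open Scope complex_scope.

Fixpoint rudin_shapiro (R : realType) (k : nat) : {poly R[i]} * {poly R[i]} :=
  if k is k'.+1 then
    let: (P, Q) := rudin_shapiro R k' in
    (P + 'X^(2 ^ k')%N * Q, P - 'X^(2 ^ k')%N * Q)
  else (1, 1).

Definition rudin_shapiroP (R : realType) (k : nat) : {poly R[i]} :=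
  (rudin_shapiro R k).1.

Definition rudin_shapiroQ (R : realType) (k : nat) : {poly R[i]} :=
  (rudin_shapiro R k).2.

Definition expi (R : realType) (t : R) : R[i] := cos t +i* sin t.

(* [Normc.normc] is the real-valued complex modulus; the ring_scope norm on [R[i]]
   takes its values in [R[i]]. *)
Definition modulus_sq (R : realType) (f : {poly R[i]}) (t : R) : R :=
  Normc.normc f.[expi t] ^+ 2.

(* The circle R (mod 2 pi) is represented by the fundamental domain [0, 2 pi),
   so distinct points of the circle are distinct reals of this interval. A set
   with infinitely many points has at least [x] points for every [x]. *)
Definition at_least_on_circle (R : realType) (x : R) (S : set R) : Prop :=
  exists s : seq R,
    [/\ uniq s,
        (forall t, t \in s -> 0 <= t < 2 * pi),
        (forall t, t \in s -> S t)
      & x <= (size s)%:R].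

(* Main.v *)
(* Write [n = 2^k], [|P_k|^2 = n (1 + x)], [|Q_k|^2 = n (1 - x)] and
   [P_k conj(Q_k) = n (y + i v)]. The vector [(x, y, v)] lies on the unit sphere
   and evolves by rotations, so that the solutions sought are the points where
   [x] takes a given small value [eta].
   On the Fourier side the recursion decouples: the frequencies [j] and [n - j]
   only see each other, through two 3x3 matrices that contract a common quadratic
   form by [3/4], and hence every Fourier coefficient of [x] has square at most
   [(3/4)^k]. On the other hand the mean square of [x] is at least [1/4].
   Sample [x] on the [N = 2n]-th roots of unity. By Plancherel, the sums of [x]
   over windows of [L] consecutive samples have mean square at most
   [N L (3/4)^k], which for [L] of order [N (3/4)^k] is too small compared with
   the mean of [|x|] unless [x - eta] changes sign at least [c (4/3)^k] times;
   and [4/3 > 2^0.36]. *)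

Require Import Defs.
From mathcomp Require Import all_boot all_order all_algebra.
From mathcomp Require Import complex.
From mathcomp Require Import all_classical all_reals all_analysis.
From mathcomp Require Import zify ring lra.

Import Order.TTheory GRing.Theory Num.Theory.
Import numFieldNormedType.Exports.

Local Open Scope classical_set_scope.
Local Open Scope ring_scope.
Local Open Scope complex_scope.

(** * Fourier coefficients of the Stokes vector *)

(* Fourier coefficients of the functions [x_k] and [y_k - i v_k] of [stokes] below;
   those of [y_k + i v_k] are obtained by [j -> - j]. *)
Fixpoint stokes_coef (F : realFieldType) (k : nat) : (int -> F) * (int -> F) :=
  if k is k'.+1 then
    let N := (2 ^ k')%N%:Z in
    let X := (stokes_coef F k').1 in
    let Y := (stokes_coef F k').2 in
    (fun j => (Y (- j - N) + Y (j - N)) / 2,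
     fun j => X j + (Y (- j - N) - Y (j - N)) / 2)
  else (fun=> 0, fun j => (j == 0)%:R).

Definition xcoef (F : realFieldType) k (j : int) : F := (stokes_coef F k).1 j.
Definition scoef (F : realFieldType) k (j : int) : F := (stokes_coef F k).2 j.

Section StokesCoef.
Variable F : realFieldType.
Local Notation X := (@xcoef F).
Local Notation Y := (@scoef F).

Lemma xcoefS k j : X k.+1 j =
  (Y k (- j - (2 ^ k)%N%:Z) + Y k (j - (2 ^ k)%N%:Z)) / 2.
Proof. by []. Qed.

Lemma scoefS k j : Y k.+1 j =
  X k j + (Y k (- j - (2 ^ k)%N%:Z) - Y k (j - (2 ^ k)%N%:Z)) / 2.
Proof. by []. Qed.

Lemma pow2SZ k : (2 ^ k.+1)%N%:Z = (2 ^ k)%N%:Z + (2 ^ k)%N%:Z.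
Proof. by rewrite expnS; lia. Qed.

Lemma pow2Z_gt0 k : 0 < (2 ^ k)%N%:Z.
Proof. by rewrite ltz_nat expn_gt0. Qed.

Lemma stokes_coef_supp k j :
  j <= - (2 ^ k)%N%:Z \/ (2 ^ k)%N%:Z <= j -> X k j = 0 /\ Y k j = 0.
Proof.
elim: k j => [|k IHk] j.
  move=> hj; split=> //; rewrite /scoef /=.
  case: eqP => // j0. lia.
rewrite xcoefS scoefS pow2SZ.
move: (pow2Z_gt0 k) IHk; set N := (2 ^ k)%N%:Z => N0 IHk hj.
have [-> _] : X k j = 0 /\ Y k j = 0 by apply: IHk; lia.
have [_ ->] : X k (- j - N) = 0 /\ Y k (- j - N) = 0 by apply: IHk; lia.
have [_ ->] : X k (j - N) = 0 /\ Y k (j - N) = 0 by apply: IHk; lia.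
by rewrite subr0 add0r mul0r addr0.
Qed.

Lemma scoef_supp k j : j <= - (2 ^ k)%N%:Z \/ (2 ^ k)%N%:Z <= j -> Y k j = 0.
Proof. by move/stokes_coef_supp => []. Qed.

Lemma xcoef_supp k j : j <= - (2 ^ k)%N%:Z \/ (2 ^ k)%N%:Z <= j -> X k j = 0.
Proof. by move/stokes_coef_supp => []. Qed.

Lemma xcoefN k j : X k (- j) = X k j.
Proof. by case: k => // k; rewrite !xcoefS opprK addrC. Qed.

Lemma xcoef0 k : X k 0 = 0.
Proof.
case: k => // k; rewrite xcoefS oppr0 sub0r scoef_supp; last by left.
by rewrite addr0 mul0r.
Qed.

Lemma scoef0 k : Y k.+1 0 = 0.
Proof.
by rewrite scoefS xcoef0 oppr0 subrr mul0r addr0.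
Qed.

(* The pair of frequencies [j], [2^k - j] carries the vector
   [(x, s, r) = (X j, Y (j - 2^k), Y (2^k - j))], which evolves by one of the two
   linear maps [(s/2, r/2, -r/2)] and [(r/2, x + s/2, x - s/2)]. Both contract the
   quadratic form [8 x^2 + 3 (s^2 + r^2)] by the factor [3/4]. *)
Lemma stokes_coef_energy k (j : int) : 0 < j -> j < (2 ^ k)%N%:Z ->
  8 * X k j ^+ 2 + 3 * (Y k (j - (2 ^ k)%N%:Z) ^+ 2 + Y k ((2 ^ k)%N%:Z - j) ^+ 2)
    <= 14 / 3 * (3 / 4) ^+ k.
Proof.
elim: k j => [|k IHk] j j0.
  by move=> j1; exfalso; lia.
rewrite pow2SZ; move: (pow2Z_gt0 k) => N0 jN.
have [jlt|jgt|jeq] := ltrgtP j (2 ^ k)%N%:Z.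
- have := IHk _ j0 jlt; rewrite xcoefS !scoefS (exprS (3 / 4)).
  move: (@scoef_supp k) (@xcoef_supp k); set N := (2 ^ k)%N%:Z => Ys Xs.
  rewrite (Ys (- j - N)); last by left; lia.
  rewrite (Xs (j - (N + N))); last by left; lia.
  rewrite (_ : - (j - (N + N)) - N = N - j); last lia.
  rewrite (Ys (j - (N + N) - N)); last by left; lia.
  rewrite (Xs (N + N - j)); last by right; lia.
  rewrite (Ys (- (N + N - j) - N)); last by left; lia.
  rewrite (_ : N + N - j - N = N - j); last lia.
  move: (X k j) (Y k (j - N)) (Y k (N - j)) ((3 / 4) ^+ k) => x s r e.
  move: (sqr_ge0 x) (sqr_ge0 s) (sqr_ge0 r); rewrite !expr2 => x2 s2 r2 h.
  by lra.
(* Here [j] is beyond the range of level [k]; its partner [2^(k+1) - j] is within it. *)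
- have := IHk ((2 ^ k)%N%:Z + (2 ^ k)%N%:Z - j); rewrite xcoefS !scoefS (exprS (3 / 4)).
  move: (@scoef_supp k) (@xcoefN k); set N := (2 ^ k)%N%:Z => Ys XN IH.
  have {IH} := IH ltac:(lia) ltac:(lia).
  rewrite (Ys (- j - N)); last by left; lia.
  rewrite -(XN (N + N - j)) opprB.
  rewrite (_ : - (j - (N + N)) - N = N - j); last lia.
  rewrite (Ys (j - (N + N) - N)); last by left; lia.
  rewrite (_ : N + N - j - N = N - j); last lia.
  rewrite (_ : N + (j - (N + N)) = j - N); last lia.
  move: (X k _) (Y k (j - N)) (Y k (N - j)) ((3 / 4) ^+ k) => x r s e.
  move: (sqr_ge0 x) (sqr_ge0 s) (sqr_ge0 r); rewrite !expr2 => x2 s2 r2 h.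
  by lra.
- rewrite {j j0 jN}jeq xcoefS !scoefS (exprS (3 / 4)).
  move: (@scoef_supp k) (@xcoef_supp k) N0 {IHk}.
  set N := (2 ^ k)%N%:Z => Ys Xs N0.
  rewrite (Ys (- N - N)); last by left; lia.
  rewrite subrr (Xs (N - (N + N))); last by left; lia.
  rewrite (_ : - (N - (N + N)) - N = 0); last lia.
  rewrite (Ys (N - (N + N) - N)); last by left; lia.
  rewrite addrK (Xs N); last by right.
  rewrite (Ys (- N - N)); last by left; lia.
  rewrite subrr {Ys Xs N0}/N.
  (* At the new middle frequency only [Y k 0] enters, with energy [7/2 * (Y k 0)^2]. It is 1 for
     [k = 0], whence the constant [14/3 = (7/2) / (3/4)], and 0 afterwards. *)
  case: k => [|k]; first by rewrite /scoef /= expr0 !expr2; lra.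
  have := exprn_ge0 k.+1 (_ : 0 <= 3 / 4 :> F); rewrite scoef0 !expr2.
  by move: (_ ^+ k.+1) => e /(_ ltac:(lra)) e0; lra.
Qed.

Lemma xcoef_sqr_le k j : X k j ^+ 2 <= (3 / 4) ^+ k.
Proof.
have e0 : 0 <= (3 / 4) ^+ k :> F by apply: exprn_ge0; lra.
wlog j0 : j / 0 <= j => [H|].
  by case: (leP 0 j) => [|/ltW] hj; [exact: H | rewrite -xcoefN H ?oppr_ge0].
have [jN|jN] := leP (2 ^ k)%N%:Z j; first by rewrite xcoef_supp ?expr0n //; right.
move: j0; rewrite le_eqVlt => /predU1P[<-|j0]; first by rewrite xcoef0 expr0n.
have := stokes_coef_energy _ _ j0 jN.
have := sqr_ge0 (Y k (j - (2 ^ k)%N%:Z)); have := sqr_ge0 (Y k ((2 ^ k)%N%:Z - j)).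
by move: (X k j ^+ 2) (Y k _ ^+ 2) (Y k _ ^+ 2) => a b c; lra.
Qed.
End StokesCoef.

(** * Discrete Fourier transform *)

(** Frequencies are integers, so that passing to [- j] can replace complex conjugation and
    everything stays bilinear over any field. *)
Definition dft (C : fieldType) (N : nat) (w : C) (f : nat -> C) (j : int) : C :=
  \sum_(0 <= a < N) f a * w ^ (- (j * a%:Z)).

Definition window (V : nmodType) (L : nat) (g : nat -> V) (a : nat) : V :=
  \sum_(0 <= b < L) g (a + b)%N.

Lemma sum_periodic_shift (V : nmodType) (N b : nat) (G : nat -> V) :
  (forall a, G (a + N)%N = G a) ->
  \sum_(0 <= a < N) G (a + b)%N = \sum_(0 <= a < N) G a.
Proof.
move=> GN; case: N GN => [|N] GN; first by rewrite !big_nil.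
elim: b => [|b IHb]; first by apply: eq_bigr => a _; rewrite addn0.
rewrite -IHb [LHS]big_nat_recr //= [RHS]big_nat_recl //= addrC; congr (_ + _).
  by rewrite add0n -(GN b) addnC addSnnS.
by apply: eq_bigr => a _; rewrite addSnnS.
Qed.

Lemma sum_prefix (V : nzRingType) (N L : nat) (G : nat -> V) : (L <= N)%N ->
  \sum_(0 <= a < N) (a < L)%:R * G a = \sum_(0 <= a < L) G a.
Proof.
move=> LN; rewrite (big_cat_nat (leq0n L) LN) /= [X in _ + X]big_nat_cond.
rewrite [X in _ + X]big1 ?addr0 => [|b /andP[/andP[Lb _] _]].
  by apply: eq_big_nat => b /andP[_ ->]; rewrite mul1r.
by rewrite ltnNge Lb mul0r.
Qed.

Section DFT.
Variables (C : fieldType) (N : nat) (w : C).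
Hypothesis w_prim : N.-primitive_root w.
Local Notation dft := (dft C N w).

Lemma prim_root_neq0 : w != 0.
Proof.
apply/eqP => w0; have := prim_expr_order w_prim; have N0 := prim_order_gt0 w_prim.
by rewrite w0 expr0n eqn0Ngt N0 /= => /esym/eqP; rewrite oner_eq0.
Qed.

Lemma prim_exprzD (m n : int) : w ^ (m + n) = w ^ m * w ^ n.
Proof. by rewrite expfzDr // prim_root_neq0. Qed.

Lemma prim_exprz_order (m : int) : w ^ (m * N%:Z) = 1.
Proof. by rewrite mulrC -exprz_exp -exprnP (prim_expr_order w_prim) exp1rz. Qed.

Lemma prim_exprz_eq1 (m : int) : (w ^ m == 1) = (N %| `|m|)%N.
Proof.
rewrite (prim_order_dvd w_prim); case: m => n; first by rewrite -exprnP.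
by rewrite NegzE abszN -invr_expz invr_eq1 -exprnP.
Qed.

Lemma sum_prim_root (m : int) :
  \sum_(0 <= a < N) w ^ (m * a%:Z) = if (N %| `|m|)%N then N%:R else 0.
Proof.
under eq_bigr do rewrite -exprz_exp -exprnP.
rewrite -prim_exprz_eq1; case: eqP => [->|/eqP wm].
  by under eq_bigr do rewrite expr1n; rewrite sumr_const_nat subn0.
apply: (mulfI (_ : w ^ m - 1 != 0)); first by rewrite subr_eq0.
by rewrite big_mkord -subrX1 mulr0 exprnP exprz_exp prim_exprz_order subrr.
Qed.

Lemma dftD f g j : dft (fun a => f a + g a) j = dft f j + dft g j.
Proof. by rewrite -big_split; apply: eq_bigr => a _; rewrite /= mulrDl. Qed.

Lemma dftZ c f j : dft (fun a => c * f a) j = c * dft f j.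
Proof. by rewrite /dft big_distrr; apply: eq_bigr => a _; rewrite /= mulrA. Qed.

Lemma dft_modulate f (m j : int) : dft (fun a => w ^ (m * a%:Z) * f a) j = dft f (j - m).
Proof.
apply: eq_bigr => a _; rewrite [_ * f a]mulrC -mulrA -prim_exprzD; congr (_ * w ^ _).
by ring.
Qed.

(** Expanding the product and summing over [j] first, orthogonality of the characters leaves only
    the diagonal [b = a]. *)
Lemma dft_plancherel f g :
  \sum_(0 <= j < N) dft f j%:Z * dft g (- j%:Z) = N%:R * \sum_(0 <= a < N) f a * g a.
Proof.
transitivity (\sum_(0 <= j < N) \sum_(0 <= a < N) \sum_(0 <= b < N)
    f a * g b * w ^ ((b%:Z - a%:Z) * j%:Z)).
  apply: eq_bigr => j _; rewrite /dft big_distrl; apply: eq_bigr => a _ /=.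
  rewrite big_distrr; apply: eq_bigr => b _ /=.
  rewrite (_ : (b%:Z - a%:Z) * j%:Z = - (j%:Z * a%:Z) - - j%:Z * b%:Z); last by ring.
  by rewrite prim_exprzD; ring.
rewrite exchange_big big_distrr /=; apply: eq_big_nat => a /andP[_ aN].
rewrite exchange_big /= (bigD1_seq a) ?mem_index_iota ?iota_uniq //=.
rewrite -big_distrr /= sum_prim_root subrr /= dvdn0 big_nat_cond big1 => [|b].
  by rewrite addr0 mulrC.
rewrite -andbA => /and3P[_ bN ba]; rewrite -big_distrr /= sum_prim_root.
case: ifP; rewrite ?mulr0 //; move: ba; have [->//|/eqP ne] := eqVneq b a => _.
by move=> /dvdnP[q Eq]; exfalso; case: q Eq => [|q] Eq; nia.
Qed.

(** A window sum is a correlation with the indicator of [[0, L)], so its transform acquires a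
    Dirichlet kernel as a factor. *)
Lemma dft_window L f j : (forall a, f (a + N)%N = f a) ->
  dft (window C L f) j = (\sum_(0 <= b < L) w ^ (j * b%:Z)) * dft f j.
Proof.
move=> fN; rewrite /dft; under eq_bigr do rewrite big_distrl.
rewrite exchange_big big_distrl; apply: eq_bigr => b _ /=.
rewrite -(@sum_periodic_shift _ N b (fun a => f a * w ^ (- (j * a%:Z)))); last first.
  move=> a; rewrite fN PoszD (_ : - (j * (a%:Z + N%:Z)) = - (j * a%:Z) + (- j) * N%:Z).
    by rewrite prim_exprzD prim_exprz_order mulr1.
  by ring.
rewrite big_distrr; apply: eq_bigr => a _ /=.
rewrite mulrCA -prim_exprzD PoszD; congr (_ * w ^ _); ring.
Qed.

Lemma sum_exprz_box L j : (L <= N)%N ->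
  \sum_(0 <= b < L) w ^ (j * b%:Z) = dft (fun a => (a < L)%:R) (- j).
Proof.
move=> LN; rewrite /dft (sum_prefix _ _ _ _ LN); apply: eq_bigr => b _.
by congr (w ^ _); ring.
Qed.

End DFT.

(** By Plancherel, [N] times the left side is the sum of [D j * D (- j)], [D] the Dirichlet kernel,
    against the spectrum of [g], which is at most [N^2 M]. Plancherel for the indicator of [[0, L)]
    gives the kernel total mass [N L]. *)
Lemma window_sqr_sum_le (C : numClosedFieldType) (N L : nat) (w : C)
    (g : nat -> C) (M : C) :
  N.-primitive_root w -> (L <= N)%N -> (forall a, g (a + N)%N = g a) ->
  (forall j : nat, (j < N)%N ->
     dft C N w g j%:Z * dft C N w g (- j%:Z) <= N%:R ^+ 2 * M) ->
  \sum_(0 <= a < N) window C L g a ^+ 2 <= N%:R ^+ 2 * M * L%:R.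
Proof.
move=> wP LN gN gM; have N0 := prim_order_gt0 wP.
have NC0 : 0 < N%:R :> C by rewrite ltr0n.
pose D (j : int) := \sum_(0 <= b < L) w ^ (j * b%:Z).
have w1 : `|w| = 1.
  by apply/eqP; rewrite -(pexpr_eq1 (n := N)) // -normrX (prim_expr_order wP) normr1.
have wJ : Num.conj w = w^-1 by rewrite invC_norm w1 expr1n invr1 mul1r.
(* Since [w] has modulus 1, this product is the squared modulus of [D j]. *)
have D0 j : 0 <= D j * D (- j).
  rewrite (_ : D (- j) = Num.conj (D j)) ?mul_conjC_ge0 // /D rmorph_sum /=.
  by apply: eq_bigr => b _; rewrite fmorphXz /= wJ mulNr exprz_inv.
rewrite -(ler_pM2l NC0).
under eq_bigr do rewrite expr2.
rewrite -(dft_plancherel _ _ _ wP).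
have -> : N%:R * (N%:R ^+ 2 * M * L%:R) =
    \sum_(0 <= j < N) D j%:Z * D (- j%:Z) * (N%:R ^+ 2 * M).
  rewrite -big_distrl /= /D.
  under eq_bigr do rewrite !(sum_exprz_box _ _ _ _ _ LN) opprK mulrC.
  rewrite (dft_plancherel _ _ _ wP) (sum_prefix _ _ _ _ LN).
  rewrite (eq_big_nat _ _ (F2 := fun=> 1)) => [|b /andP[_ ->]] //.
  by rewrite sumr_const_nat subn0; ring.
rewrite !big_nat; apply: ler_sum => j /andP[_ jN].
rewrite !(dft_window _ _ _ wP) // mulrACA.
by apply: ler_wpM2l; [exact: D0 | exact: gM].
Qed.

(** * Sign changes of periodic sequences *)

Lemma sum_const_natr (V : nzRingType) (n : nat) (c : V) :
  \sum_(0 <= a < n) c = n%:R * c.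
Proof. by rewrite sumr_const_nat subn0 mulr_natl. Qed.

Section Descents.
Variables (F : realFieldType) (N L : nat) (g : nat -> F) (eta : F).
Hypothesis gN : forall a, g (a + N)%N = g a.

Local Notation above a := (eta <= g a).

(** Only passages from [>=] to [<] count: strictness at the right end will keep the resulting zeros
    distinct. *)
Definition descents : nat :=
  (\sum_(0 <= a < N) (above a && ~~ above a.+1))%N.

(** Around a full period ascents and descents balance. Adding the number of [above] indices to both
    sides, shifted by one on the right, reduces this to a pointwise identity. *)
Lemma sum_sign_changes :
  (\sum_(0 <= a < N) (above a != above a.+1))%N = (2 * descents)%N.
Proof.
apply/(@addIn (\sum_(0 <= a < N) above a)%N).
rewrite -{2}(@sum_periodic_shift _ N 1 (fun a => nat_of_bool (above a))); last first.
  by move=> a; rewrite gN.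
rewrite /descents big_distrr -!big_split /=; apply: eq_bigr => a _.
by rewrite addn1; case: (above a); case: (above a.+1).
Qed.

Lemma no_sign_change a :
  (\sum_(0 <= b < L) (above (a + b)%N != above (a + b).+1))%N = 0%N ->
  forall b, (b < L)%N -> above (a + b)%N = above a.
Proof.
move=> /eqP; rewrite sum_nat_seq_eq0 => /allP ch; elim=> [|b IHb] bL.
  by rewrite addn0.
have := ch b; rewrite mem_index_iota (ltnW bL) eqb0 negbK => /(_ isT) /eqP e.
by rewrite addnS -e IHb // ltnW.
Qed.

(** Without a sign change in the window all terms [g - eta] have one sign and the absolute values
    can be pulled out of the sum. Otherwise the count is at least 1 and the trivial bound
    [L (1 + |eta|)] suffices. *)
Lemma sum_norm_window (a : nat) : (forall b, `|g b| <= 1) ->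
  \sum_(0 <= b < L) `|g (a + b)%N - eta| <=
    `|window F L g a| + L%:R * `|eta| + L%:R * (1 + `|eta|) *
      (\sum_(0 <= b < L) (above (a + b)%N != above (a + b).+1))%N%:R.
Proof.
move=> g1; have L0 : 0 <= L%:R :> F by rewrite ler0n.
have e0 := normr_ge0 eta; have w0 := normr_ge0 (window F L g a).
have sumE : \sum_(0 <= b < L) (g (a + b)%N - eta) = window F L g a - L%:R * eta.
  by rewrite sumrB sum_const_natr.
have le_e : `|window F L g a - L%:R * eta| <= `|window F L g a| + L%:R * `|eta|.
  by rewrite (le_trans (ler_normB _ _)) // normrM normr_nat.
set c := (\sum_(0 <= b < L) _)%N; case: (posnP c) => [c0|c_gt0].
  rewrite c0 mulr0 addr0; apply: le_trans le_e; rewrite -sumE.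
  have same := no_sign_change a c0.
  have [ha|ha] := boolP (above a).
    rewrite ger0_norm; last first.
      by rewrite big_nat sumr_ge0 // => b /andP[_ bL]; rewrite subr_ge0 same.
    rewrite le_eqVlt; apply/orP; left; apply/eqP/eq_big_nat => b /andP[_ bL].
    by rewrite ger0_norm // subr_ge0 same.
  rewrite ler0_norm; last first.
    rewrite big_nat sumr_le0 // => b /andP[_ bL].
    by rewrite subr_le0 ltW // ltNge same.
  rewrite -sumrN le_eqVlt; apply/orP; left; apply/eqP/eq_big_nat => b /andP[_ bL].
  by rewrite ler0_norm // subr_le0 ltW // ltNge same.
apply: (@le_trans _ _ (L%:R * (1 + `|eta|))).
  rewrite -sum_const_natr.
  by apply: ler_sum => b _; rewrite (le_trans (ler_normB _ _)) // lerD2r.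
have c1 : 1 <= c%:R :> F by rewrite ler1n.
by rewrite -[X in X <= _]add0r lerD ?addr_ge0 ?mulr_ge0 // ler_peMr ?mulr_ge0 ?addr_ge0.
Qed.

(* A window of [L] consecutive samples without a sign change of [g - eta] has
   [l1]-mass [|sum|], so small window sums force sign changes. *)
Lemma many_descents : (0 < L)%N -> (forall b, `|g b| <= 1) -> `|eta| <= 1 / 2048 ->
  N%:R / 4 <= \sum_(0 <= a < N) `|g a| ->
  \sum_(0 <= a < N) window F L g a ^+ 2 <= N%:R * L%:R ^+ 2 / 64 ->
  N%:R <= 20 * L%:R * descents%:R :> F.
Proof.
move=> L0 g1 e1 gl1 gl2.
have LF0 : 0 < L%:R :> F by rewrite ltr0n.
have NF0 : 0 <= N%:R :> F by rewrite ler0n.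
have e0 := normr_ge0 eta; have D0 : 0 <= descents%:R :> F by rewrite ler0n.
rewrite -[20 * _ * _]mulrA.
have shift (G : nat -> F) : (forall a, G (a + N)%N = G a) ->
    \sum_(0 <= a < N) \sum_(0 <= b < L) G (a + b)%N =
    L%:R * \sum_(0 <= a < N) G a.
  move=> GN; rewrite exchange_big /= -sum_const_natr.
  by apply: eq_bigr => b _; rewrite sum_periodic_shift.
(* The previous bound summed over all windows: each sample and each sign change lies in exactly [L]
   of them. *)
have H1 : L%:R * (\sum_(0 <= a < N) `|g a| - N%:R * `|eta|) <=
    \sum_(0 <= a < N) `|window F L g a| + N%:R * (L%:R * `|eta|) +
    L%:R * (1 + `|eta|) * (L%:R * (2 * descents%:R)).
  have -> : L%:R * (2 * descents%:R) = \sum_(0 <= a < N)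
      (\sum_(0 <= b < L) (above (a + b)%N != above (a + b).+1))%N%:R :> F.
    rewrite -natrM -sum_sign_changes natr_sum -shift; last by move=> a; rewrite -addSn !gN.
    by apply: eq_bigr => a _; rewrite natr_sum.
  rewrite big_distrr /= -[N%:R * (L%:R * _)]sum_const_natr -!big_split /=.
  apply: (@le_trans _ _ (\sum_(0 <= a < N) \sum_(0 <= b < L) `|g (a + b)%N - eta|)).
    rewrite (shift (fun a => `|g a - eta|)) => [|a]; last by rewrite gN.
    rewrite ler_pM2l // -[N%:R * _]sum_const_natr -sumrB.
    by apply: ler_sum => a _; rewrite lerBlDr -{1}(subrK eta (g a)) ler_normD.
  by apply: ler_sum => a _; exact: sum_norm_window.
(* AM-GM: [|u| <= 4 u^2 / L + L / 16] *)
have H2 : L%:R * \sum_(0 <= a < N) `|window F L g a| <=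
    4 * \sum_(0 <= a < N) window F L g a ^+ 2 + N%:R * (L%:R ^+ 2 / 16).
  rewrite !big_distrr /= -[N%:R * _]sum_const_natr -big_split /=.
  apply: ler_sum => a _; rewrite -real_normK ?num_real //.
  have := sqr_ge0 (8 * `|window F L g a| - L%:R).
  by move: `|_| => u; rewrite !expr2; lra.
have H3 : \sum_(0 <= a < N) `|window F L g a| <= N%:R * L%:R / 8.
  rewrite -(ler_pM2l LF0); apply: le_trans H2 _; rewrite expr2; move: gl2; rewrite expr2.
  by lra.
have H4 : N%:R * `|eta| <= N%:R / 2048.
  by apply: ler_wpM2l => //; lra.
have H5 : L%:R * descents%:R * `|eta| <= L%:R * descents%:R / 2048.
  by apply: ler_wpM2l; [rewrite mulr_ge0 // ltW | lra].
move: H1; move: (\sum_(0 <= a < N) `|window F L g a|) H3 => W H3 H1.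
have {}H1 : L%:R * (N%:R / 4 - N%:R * `|eta|) <=
    L%:R * (N%:R / 8 + N%:R * `|eta| +
    (1 + `|eta|) * (L%:R * (2 * descents%:R))).
  apply: le_trans (_ : _ <= L%:R * (\sum_(0 <= a < N) `|g a| - N%:R * `|eta|)) _.
    by rewrite ler_pM2l // lerD2r.
  by apply: le_trans H1 _; lra.
(* What remains is [N (1/8 - 1/1024) <= (2 + 1/1024) * L * descents], so the factor 20 leaves
   room. *)
move: H1; rewrite ler_pM2l //; move: H4 H5.
move: (N%:R * `|eta|) => ne H4.
have -> : (1 + `|eta|) * (L%:R * (2 * descents%:R)) =
   2 * (L%:R * descents%:R) + 2 * (L%:R * descents%:R * `|eta|) by ring.
have : 0 <= L%:R * descents%:R :> F by rewrite mulr_ge0 // ltW.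
move: (L%:R * descents%:R) => ld ld0.
by move: (ld * `|eta|) => x; lra.
Qed.

End Descents.

(** * Stokes vector of the Rudin-Shapiro pair *)

(** The new [x] and [- v] are the real and imaginary parts of [e^(-iu) (y + i v)]; the start
    [(0, 1, 0)] is [P = Q = 1]. *)
Fixpoint stokes (R : realType) (k : nat) (t : R) : R * R * R :=
  if k is k'.+1 then
    let: (x, y, v) := stokes R k' t in
    let u := (2 ^ k')%N%:R * t in
    (y * cos u + v * sin u, x, y * sin u - v * cos u)
  else (0, 1, 0).

Section Stokes.
Variable R : realType.
Local Notation sx k t := (stokes R k t).1.1.
Local Notation sy k t := (stokes R k t).1.2.
Local Notation sv k t := (stokes R k t).2.

Lemma stokesS k t : let u := (2 ^ k)%N%:R * t in
  stokes R k.+1 t = (sy k t * cos u + sv k t * sin u, sx k t,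
                     sy k t * sin u - sv k t * cos u).
Proof. by rewrite /=; case: (stokes R k t) => [[x y] v]. Qed.

Lemma stokes_sphere k t : sx k t ^+ 2 + sy k t ^+ 2 + sv k t ^+ 2 = 1.
Proof.
elim: k => [|k IHk]; first by rewrite /=; ring.
rewrite stokesS /=; move: IHk (cos2Dsin2 ((2 ^ k)%N%:R * t)).
move: (sx k t) (sy k t) (sv k t) (cos _) (sin _) => x y v c s h cs1.
have -> : (y * c + v * s) ^+ 2 + x ^+ 2 + (y * s - v * c) ^+ 2 =
  x ^+ 2 + (y ^+ 2 + v ^+ 2) * (c ^+ 2 + s ^+ 2) by ring.
by rewrite cs1 mulr1 addrA.
Qed.

Lemma stokes_x_le1 k t : `|sx k t| <= 1.
Proof.
rewrite -(@expr_le1 _ 2) ?normr_ge0 // real_normK ?num_real // -(stokes_sphere k t).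
by rewrite -addrA lerDl addr_ge0 ?sqr_ge0.
Qed.

Lemma stokes_continuous k : [/\ continuous (fun t : R => sx k t),
  continuous (fun t : R => sy k t) & continuous (fun t : R => sv k t)].
Proof.
elim: k => [|k [cx cy cv]]; first by split=> t; exact: cvg_cst.
have cu : continuous (fun t : R => (2 ^ k)%N%:R * t) by exact: mulrl_continuous.
have cc : continuous (fun t : R => cos ((2 ^ k)%N%:R * t)).
  by move=> t; apply: (continuous_comp (cu t)); exact: continuous_cos.
have cs : continuous (fun t : R => sin ((2 ^ k)%N%:R * t)).
  by move=> t; apply: (continuous_comp (cu t)); exact: continuous_sin.
split=> t.
- have -> : (fun t : R => sx k.+1 t) = (fun t : R => sy k t) \* (fun t => cos ((2 ^ k)%N%:R * t))
      \+ (fun t => sv k t) \* (fun t => sin ((2 ^ k)%N%:R * t)).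
    by apply/funext => r; rewrite stokesS.
  by apply: continuousD; apply: continuousM; [exact: cy|exact: cc|exact: cv|exact: cs].
- have -> : (fun t : R => sy k.+1 t) = (fun t : R => sx k t).
    by apply/funext => r; rewrite stokesS.
  exact: cx.
- have -> : (fun t : R => sv k.+1 t) = (fun t : R => sy k t) \* (fun t => sin ((2 ^ k)%N%:R * t))
      \- (fun t => sv k t) \* (fun t => cos ((2 ^ k)%N%:R * t)).
    by apply/funext => r; rewrite stokesS.
  by apply: continuousB; apply: continuousM; [exact: cy|exact: cs|exact: cv|exact: cc].
Qed.

Lemma expiD (s t : R) : expi (s + t) = expi s * expi t.
Proof. by rewrite /expi cosD sinD; apply/eqP; rewrite eq_complex /= eqxx addrC eqxx. Qed.

Lemma expi0 : expi (0 : R) = 1.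
Proof. by rewrite /expi cos0 sin0. Qed.

Lemma expi_mulrn n (t : R) : expi (n%:R * t) = expi t ^+ n.
Proof.
elim: n => [|n IHn]; first by rewrite mul0r expr0 expi0.
by rewrite exprS -IHn -expiD -{2}[t]mul1r -mulrDl nat1r.
Qed.

Lemma normc_sqr (z : R[i]) : Normc.normc z ^+ 2 = complex.Re z ^+ 2 + complex.Im z ^+ 2.
Proof. by case: z => a b /=; rewrite sqr_sqrtr // addr_ge0 ?sqr_ge0. Qed.

(** With [z = e^(iu)], these come from expanding the squared moduli of [p + z q] and [p - z q], and
    the product of [p + z q] with the conjugate of [p - z q]. The four go through one induction,
    since the moduli and the product feed each other. *)
Lemma rudin_shapiro_stokes k t (p := (rudin_shapiroP R k).[expi t])
    (q := (rudin_shapiroQ R k).[expi t]) :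
  [/\ complex.Re p ^+ 2 + complex.Im p ^+ 2 = (2 ^ k)%N%:R * (1 + sx k t),
      complex.Re q ^+ 2 + complex.Im q ^+ 2 = (2 ^ k)%N%:R * (1 - sx k t),
      complex.Re p * complex.Re q + complex.Im p * complex.Im q = (2 ^ k)%N%:R * sy k t
    & complex.Im p * complex.Re q - complex.Re p * complex.Im q = (2 ^ k)%N%:R * sv k t].
Proof.
rewrite {}/p {}/q; elim: k => [|k [IHp IHq IHy IHv]].
  by rewrite /rudin_shapiroP /rudin_shapiroQ /= !hornerC /=; split; ring.
have -> : (rudin_shapiroP R k.+1).[expi t] = (rudin_shapiroP R k).[expi t] +
    expi ((2 ^ k)%N%:R * t) * (rudin_shapiroQ R k).[expi t].
  rewrite /rudin_shapiroP /rudin_shapiroQ /=; case: (rudin_shapiro R k) => P Q /=.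
  by rewrite hornerD hornerM hornerXn expi_mulrn.
have -> : (rudin_shapiroQ R k.+1).[expi t] = (rudin_shapiroP R k).[expi t] -
    expi ((2 ^ k)%N%:R * t) * (rudin_shapiroQ R k).[expi t].
  rewrite /rudin_shapiroP /rudin_shapiroQ /=; case: (rudin_shapiro R k) => P Q /=.
  by rewrite hornerD hornerN hornerM hornerXn expi_mulrn.
rewrite stokesS /= /expi expnS mul2n -addnn natrD.
move: IHp IHq IHy IHv (cos2Dsin2 ((2 ^ k)%N%:R * t)).
case: _.[_] => a b; case: _.[_] => c d /=.
move: (cos _) (sin _) (sx k t) (sy k t) (sv k t) => C S x y v Hp Hq Hy Hv HC.
have H2 : (c ^+ 2 + d ^+ 2) * (C ^+ 2 + S ^+ 2) = c ^+ 2 + d ^+ 2.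
  by rewrite HC mulr1.
move: (2 ^ k)%N%:R Hp Hq Hy Hv => n Hp Hq Hy Hv.
have e1 : a ^+ 2 + b ^+ 2 + (c ^+ 2 + d ^+ 2) = 2 * n by rewrite Hp Hq; ring.
split.
- transitivity (a ^+ 2 + b ^+ 2 + (c ^+ 2 + d ^+ 2) * (C ^+ 2 + S ^+ 2)
    + 2 * C * (a * c + b * d) + 2 * S * (b * c - a * d)); first by ring.
  by rewrite H2 e1 Hy Hv; ring.
- transitivity (a ^+ 2 + b ^+ 2 + (c ^+ 2 + d ^+ 2) * (C ^+ 2 + S ^+ 2)
    - 2 * C * (a * c + b * d) - 2 * S * (b * c - a * d)); first by ring.
  by rewrite H2 e1 Hy Hv; ring.
- transitivity (a ^+ 2 + b ^+ 2 - (c ^+ 2 + d ^+ 2) * (C ^+ 2 + S ^+ 2)); first by ring.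
  by rewrite H2 Hp Hq; ring.
- transitivity (2 * S * (a * c + b * d) - 2 * C * (b * c - a * d)); first by ring.
  by rewrite Hy Hv; ring.
Qed.

Lemma modulus_sqP k t :
  modulus_sq (rudin_shapiroP R k) t = (2 ^ k)%N%:R * (1 + sx k t).
Proof. by rewrite /modulus_sq normc_sqr; case: (rudin_shapiro_stokes k t). Qed.

Lemma modulus_sqQ k t :
  modulus_sq (rudin_shapiroQ R k) t = (2 ^ k)%N%:R * (1 - sx k t).
Proof. by rewrite /modulus_sq normc_sqr; case: (rudin_shapiro_stokes k t). Qed.

Lemma expi_prim_root N : (0 < N)%N -> N.-primitive_root (expi (2 * pi / N%:R) : R[i]).
Proof.
move=> N0; have NR0 : 0 < N%:R :> R by rewrite ltr0n.
apply/andP; split=> //; apply/forallP => /= i; rewrite unity_rootE -expi_mulrn.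
apply/eqP; have [->|iN] := eqVneq i.+1 N.
  have -> : N%:R * (2 * pi / N%:R) = pi *+ 2 :> R.
    by rewrite mulrC divfK ?gt_eqF // -[RHS]mulr_natl.
  by rewrite /expi cos2pi sin2pi eqxx.
apply/negbTE/eqP => /(congr1 (@complex.Re R)) /= /eqP.
(* The half angle lies strictly between 0 and [pi], where the sine is positive, whereas cosine 1 at
   the full angle would make that sine vanish. *)
have -> : i.+1%:R * (2 * pi / N%:R) = (i.+1%:R * pi / N%:R : R) *+ 2.
  by rewrite -mulr_natr; ring.
have lt1 : 0 < i.+1%:R * @pi R / N%:R < @pi R.
  apply/andP; split.
    by apply: divr_gt0 => //; apply: mulr_gt0; [rewrite ltr0n | exact: pi_gt0].
  rewrite ltr_pdivrMr // mulrC ltr_pM2l ?pi_gt0 // ltr_nat ltn_neqAle iN.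
  exact: ltn_ord.
have := sin_gt0_pi lt1; rewrite cos_mulr2n cos2sin2.
move: (sin _) => s s0 /eqP e.
have : s ^+ 2 = 0 by lra.
by move/eqP; rewrite sqrf_eq0 gt_eqF.
Qed.

End Stokes.

(** * Sampling at roots of unity *)

Section Grid.
Variables (R : realType) (K : nat).
Local Notation N := (2 ^ K.+1)%N.
Local Notation grid a := (a%:R * (2 * pi / N%:R) : R).
Local Notation w := (expi (2 * pi / N%:R) : R[i]).
Local Notation dft := (dft R[i] N w).
Local Notation X := (fun k a => ((stokes R k (grid a)).1.1)%:C).
Local Notation S := (fun k a => (stokes R k (grid a)).1.2 +i* (stokes R k (grid a)).2).
Local Notation Sc := (fun k a => (stokes R k (grid a)).1.2 -i* (stokes R k (grid a)).2).

Lemma grid_prim_root : N.-primitive_root w.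
Proof. by apply: expi_prim_root; rewrite expn_gt0. Qed.

Lemma expiN (t : R) : expi (- t) = (expi t)^-1.
Proof.
have e : expi (- t) * expi t = 1 by rewrite -expiD addNr expi0.
by rewrite -[LHS]mulr1 -[in LHS](@divff _ (expi t)) ?mulrA ?e ?mul1r //;
  apply/eqP => t0; move/eqP: e; rewrite t0 mulr0 eq_sym oner_eq0.
Qed.

Lemma grid_expz k a : w ^ ((2 ^ k)%N%:Z * a%:Z) = expi ((2 ^ k)%N%:R * grid a).
Proof. by rewrite -PoszM -exprnP -expi_mulrn natrM -mulrA. Qed.

Lemma grid_expzN k a : w ^ (- (2 ^ k)%N%:Z * a%:Z) = expi (- ((2 ^ k)%N%:R * grid a)).
Proof. by rewrite mulNr -invr_expz grid_expz expiN. Qed.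

Definition half : R[i] := (1 / 2 : R)%:C.

(** The recursion in exponential form: the transform turns each modulation into a shift of frequency
    by [2^k]. *)
Lemma stokes_xS k a : X k.+1 a = half *
  (w ^ (- (2 ^ k)%N%:Z * a%:Z) * S k a + w ^ ((2 ^ k)%N%:Z * a%:Z) * Sc k a).
Proof.
rewrite grid_expz grid_expzN stokesS /expi cosN sinN /half.
by apply/eqP; rewrite eq_complex /=; apply/andP; split; apply/eqP; field.
Qed.

Lemma stokes_sS k a : S k.+1 a = X k a + half *
  (-1 * (w ^ (- (2 ^ k)%N%:Z * a%:Z) * S k a) + w ^ ((2 ^ k)%N%:Z * a%:Z) * Sc k a).
Proof.
rewrite grid_expz grid_expzN stokesS /expi cosN sinN /half.
by apply/eqP; rewrite eq_complex /=; apply/andP; split; apply/eqP; field.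
Qed.

Lemma stokes_scS k a : Sc k.+1 a = X k a + half *
  (w ^ (- (2 ^ k)%N%:Z * a%:Z) * S k a + -1 * (w ^ ((2 ^ k)%N%:Z * a%:Z) * Sc k a)).
Proof.
rewrite grid_expz grid_expzN stokesS /expi cosN sinN /half.
by apply/eqP; rewrite eq_complex /=; apply/andP; split; apply/eqP; field.
Qed.

Lemma dft_ext f g j : f =1 g -> dft f j = dft g j.
Proof. by move=> fg; apply: eq_bigr => a _; rewrite fg. Qed.

(** True Fourier coefficients live on [|j| < 2^k], so in this range no other frequency congruent to
    [j] modulo [N] interferes. Shifting by [2^k] takes the range of level [k + 1] into that of level
    [k]. *)
Lemma dft_stokes k (j : int) : (2 ^ k)%N%:Z - N%:Z <= j <= N%:Z - (2 ^ k)%N%:Z ->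
  [/\ dft (X k) j = N%:R * (xcoef R k j)%:C,
      dft (S k) j = N%:R * (scoef R k (- j))%:C
    & dft (Sc k) j = N%:R * (scoef R k j)%:C].
Proof.
elim: k j => [|k IHk] j /andP[j1 j2].
  have dft1 (b : R) : b = 0 -> dft (fun=> 1 +i* b) j = N%:R * (scoef R 0 j)%:C.
    move=> ->; rewrite /dft /scoef /=.
    under eq_bigr do rewrite mul1r -mulNr.
    rewrite (sum_prim_root _ _ _ grid_prim_root) abszN.
    have [->|j0] := eqVneq j 0; first by rewrite dvdn0 mulr1.
    rewrite mulr0; case: ifP => // /dvdnP[q Eq]; exfalso.
    by move: j1 j2 Eq j0; case: q => [|q]; nia.
  have -> : scoef R 0 (- j) = scoef R 0 j by rewrite /scoef /= oppr_eq0.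
  split.
  - by rewrite /dft /xcoef /= mulr0 big1 // => a _; rewrite mul0r.
  - exact: (dft1 0 erefl).
  - exact: (dft1 (- 0) (oppr0 _)).
have n0 := pow2Z_gt0 k; move: j1 j2; rewrite pow2SZ => j1 j2.
have [_ Hs _] := IHk (j + (2 ^ k)%N%:Z) ltac:(lia).
have [_ _ Hsc] := IHk (j - (2 ^ k)%N%:Z) ltac:(lia).
have [Hx _ _] := IHk j ltac:(lia).
have mS : dft (fun a => w ^ (- (2 ^ k)%N%:Z * a%:Z) * S k a) j =
    N%:R * (scoef R k (- j - (2 ^ k)%N%:Z))%:C.
  by rewrite (dft_modulate _ _ _ grid_prim_root) opprK Hs opprD.
have mSc : dft (fun a => w ^ ((2 ^ k)%N%:Z * a%:Z) * Sc k a) j =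
    N%:R * (scoef R k (j - (2 ^ k)%N%:Z))%:C.
  by rewrite (dft_modulate _ _ _ grid_prim_root) Hsc.
split.
- rewrite (dft_ext _ _ _ (stokes_xS k)) dftZ dftD mS mSc xcoefS /half.
  rewrite -mulrDr mulrCA; congr (_ * _); rewrite -rmorphD -rmorphM.
  by congr (_%:C); field.
- rewrite (dft_ext _ _ _ (stokes_sS k)) dftD dftZ dftD dftZ mS mSc Hx scoefS /half.
  rewrite xcoefN opprK -(rmorphN1 (real_complex R)) mulrCA -!mulrDr mulrCA -mulrDr.
  by congr (_ * _); rewrite -rmorphM -!rmorphD -rmorphM -rmorphD; congr (_%:C); field.
- rewrite (dft_ext _ _ _ (stokes_scS k)) dftD dftZ dftD dftZ mS mSc Hx scoefS /half.
  rewrite -(rmorphN1 (real_complex R)) mulrCA -!mulrDr mulrCA -mulrDr.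
  by congr (_ * _); rewrite -rmorphM -!rmorphD -rmorphM -rmorphD; congr (_%:C); field.
Qed.

Lemma half_mul2 : half * 2 = 1.
Proof. by rewrite /half -(rmorph_nat (real_complex R)) -rmorphM divfK ?pnatr_eq0. Qed.

(** Modulo [N], [f] has frequencies in [(-n, n)]; shifting by [n] or [- n] gives them all one strict
    sign. Those of the square are then of size strictly between 0 and [4 n <= N], so its mean is
    zero. *)
Lemma sum_sqr_modulate (f : nat -> R[i]) (n m : int) : m = n \/ m = - n ->
  0 < n -> 4 * n <= N%:Z ->
  (forall j, n <= `|j| <= N%:Z - n -> dft f j = 0) ->
  \sum_(0 <= a < N) (w ^ (m * a%:Z) * f a) ^+ 2 = 0.
Proof.
move=> mn n0 nN f0; apply: (mulfI (_ : N%:R != 0 :> R[i])).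
  by rewrite pnatr_eq0 -lt0n expn_gt0.
rewrite mulr0; under eq_bigr do rewrite expr2.
rewrite -(dft_plancherel _ _ _ grid_prim_root) big_nat big1 // => j /andP[_ jN].
rewrite !(dft_modulate _ _ _ grid_prim_root).
have [h|h] : n <= `|j%:Z - m| <= N%:Z - n \/ n <= `|- j%:Z - m| <= N%:Z - n by lia.
  by rewrite f0 ?mul0r.
by rewrite [X in _ * X]f0 ?mulr0.
Qed.

Definition grid_sqr_sum k : R := \sum_(0 <= a < N) (stokes R k (grid a)).1.1 ^+ 2.

(** Squaring the exponential form of [x], the two pure squares average to zero, and the cross term
    is [y^2 + v^2 = 1 - x^2] by the sphere equation. *)
Lemma grid_sqr_sumS k : (k < K)%N -> 2 * grid_sqr_sum k.+1 = N%:R - grid_sqr_sum k.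
Proof.
move=> kK; have n0 := pow2Z_gt0 k.
have nN : 4 * (2 ^ k)%N%:Z <= N%:Z.
  by have := leq_pexp2l (isT : 0 < 2)%N kK; rewrite !expnS; lia.
have S0 j : (2 ^ k)%N%:Z <= `|j| <= N%:Z - (2 ^ k)%N%:Z -> dft (S k) j = 0.
  move=> jn; have [_ -> _] := dft_stokes k j ltac:(lia).
  by rewrite scoef_supp ?mulr0 //; lia.
have Sc0 j : (2 ^ k)%N%:Z <= `|j| <= N%:Z - (2 ^ k)%N%:Z -> dft (Sc k) j = 0.
  move=> jn; have [_ _ ->] := dft_stokes k j ltac:(lia).
  by rewrite scoef_supp ?mulr0 //; lia.
have sqrX a : (X k.+1 a) ^+ 2 = half ^+ 2 *
   ((w ^ (- (2 ^ k)%N%:Z * a%:Z) * S k a) ^+ 2 + (w ^ ((2 ^ k)%N%:Z * a%:Z) * Sc k a) ^+ 2)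
   + half * (1 - (stokes R k (grid a)).1.1 ^+ 2)%:C.
  have -> : 1 - (stokes R k (grid a)).1.1 ^+ 2 =
      (stokes R k (grid a)).1.2 ^+ 2 + (stokes R k (grid a)).2 ^+ 2.
    have := stokes_sphere R k (grid a).
    by move: (_ ^+ 2) (_ ^+ 2) (_ ^+ 2) => x y v; lra.
  have -> : ((stokes R k (grid a)).1.2 ^+ 2 + (stokes R k (grid a)).2 ^+ 2)%:C =
      (w ^ (- (2 ^ k)%N%:Z * a%:Z) * S k a) * (w ^ ((2 ^ k)%N%:Z * a%:Z) * Sc k a).
    rewrite mulrACA -(prim_exprzD _ _ _ grid_prim_root) mulNr addNr expr0z mul1r.
    by apply/eqP; rewrite eq_complex /=; apply/andP; split; apply/eqP; ring.
  rewrite stokes_xS.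
  move: (_ * S k a) (_ * Sc k a) => x y.
  transitivity (half ^+ 2 * (x ^+ 2 + y ^+ 2) + half * (half * 2) * (x * y)); first by ring.
  by rewrite half_mul2 mulr1.
apply: complexI; rewrite rmorphM rmorph_nat rmorph_sum /=.
under eq_bigr do rewrite rmorphXn /= sqrX.
rewrite big_split -!big_distrr /= big_split /=.
rewrite (sum_sqr_modulate _ _ _ (or_intror erefl) n0 nN S0).
rewrite (sum_sqr_modulate _ _ _ (or_introl erefl) n0 nN Sc0) addr0 mulr0 add0r.
rewrite -rmorph_sum mulrA [2 * half]mulrC half_mul2 mul1r.
by rewrite sumrB sum_const_natr mulr1.
Qed.

(** The mean square evolves by [m -> (1 - m) / 2], which sends 0 to [1/2] and maps [[1/4, 1/2]] into
    itself. *)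
Lemma grid_sqr_sum_bounds k : (0 < k <= K)%N -> N%:R / 4 <= grid_sqr_sum k <= N%:R / 2.
Proof.
have N0 : 0 <= N%:R :> R by rewrite ler0n.
elim: k => // k IHk /andP[_ kK]; have := grid_sqr_sumS k kK.
case: k IHk kK => [|k] IHk kK.
  by rewrite {2}/grid_sqr_sum big1 => [|a _]; [lra | rewrite /= expr0n].
have /andP[] := IHk (ltnW kK).
by move: (grid_sqr_sum k.+1) (grid_sqr_sum k.+2) => u v; lra.
Qed.

Lemma grid_stokes_periodic a : stokes R K (grid (a + N)%N) = stokes R K (grid a).
Proof.
suff H k t : stokes R k (t + 2 * pi) = stokes R k t.
  rewrite natrD mulrDl [X in _ + X]mulrC divfK ?H // pnatr_eq0 -lt0n expn_gt0 //.
elim: k t => // k IHk t; rewrite !stokesS IHk.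
have -> : (2 ^ k)%N%:R * (t + 2 * pi) = (2 ^ k)%N%:R * t + pi *+ 2 *+ (2 ^ k)%N.
  by rewrite mulrDr; congr (_ + _); rewrite -[pi *+ 2]mulr_natl -[RHS]mulr_natl.
by rewrite (periodicn (@cosD2pi R)) (periodicn (@sinD2pi R)).
Qed.

Lemma grid_stokes_window L : (L <= N)%N ->
  \sum_(0 <= a < N) window R L (fun a => (stokes R K (grid a)).1.1) a ^+ 2 <=
    N%:R ^+ 2 * (3 / 4) ^+ K * L%:R.
Proof.
move=> LN; rewrite -lecR.
have K0 := pow2Z_gt0 K; have NE := pow2SZ K.
(* Frequencies above [N / 2] are moved by [N] into [[-2^K, 2^K]], where the transform is known. *)
have per (j : nat) : dft (X K) (- j%:Z) = dft (X K) (N%:Z - j%:Z) /\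
    dft (X K) j%:Z = dft (X K) (j%:Z - N%:Z).
  split; apply: eq_bigr => a _; congr (_ * _).
    rewrite (_ : - (- j%:Z * a%:Z) = - ((N%:Z - j%:Z) * a%:Z) + a%:Z * N%:Z); last by ring.
    by rewrite (prim_exprzD _ _ _ grid_prim_root) (prim_exprz_order _ _ _ grid_prim_root) mulr1.
  rewrite (_ : - ((j%:Z - N%:Z) * a%:Z) = - (j%:Z * a%:Z) + a%:Z * N%:Z); last by ring.
  by rewrite (prim_exprzD _ _ _ grid_prim_root) (prim_exprz_order _ _ _ grid_prim_root) mulr1.
have bound (i : int) : - (2 ^ K)%N%:Z <= i <= (2 ^ K)%N%:Z ->
    dft (X K) i * dft (X K) (- i) <= N%:R ^+ 2 * ((3 / 4) ^+ K : R)%:C.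
  move=> hi; have [-> _ _] := dft_stokes K i ltac:(lia).
  have [-> _ _] := dft_stokes K (- i) ltac:(lia).
  rewrite xcoefN mulrACA -expr2 -rmorphM -expr2 -(rmorph_nat (real_complex R)).
  by rewrite -rmorphXn -!rmorphM lecR ler_wpM2l ?sqr_ge0 ?xcoef_sqr_le.
have : \sum_(0 <= a < N) window R[i] L (X K) a ^+ 2 <=
    N%:R ^+ 2 * ((3 / 4) ^+ K : R)%:C * L%:R.
  apply: (window_sqr_sum_le _ _ _ w _ _ grid_prim_root LN) => [a|j jN].
    by rewrite grid_stokes_periodic.
  have [jK|Kj] := leqP j (2 ^ K)%N; first by apply: bound; lia.
  have [-> ->] := per j.
  by rewrite -(opprB j%:Z N%:Z); apply: bound; lia.
have win a : window R[i] L (X K) a =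
    (window R L (fun a => (stokes R K (grid a)).1.1) a)%:C by rewrite [RHS]rmorph_sum.
under eq_bigr do rewrite win -rmorphXn /=.
rewrite -rmorph_sum -(rmorph_nat (real_complex R) N) -(rmorph_nat (real_complex R) L).
by rewrite -rmorphXn -!rmorphM.
Qed.

(** The sum over a full period is the zeroth coefficient. This serves the case where the desired
    window is as long as the period or longer. *)
Lemma grid_stokes_sum0 a : window R N (fun a => (stokes R K (grid a)).1.1) a = 0.
Proof.
rewrite /window; under eq_bigr do rewrite addnC.
rewrite (sum_periodic_shift _ N a (fun a => (stokes R K (grid a)).1.1)); last first.
  by move=> b; rewrite grid_stokes_periodic.
apply: complexI; rewrite rmorph_sum /=.
have N2 := pow2SZ K; have [E _ _] := dft_stokes K 0 ltac:(lia).
rewrite xcoef0 mulr0 in E; rewrite -[RHS]E; apply: eq_bigr => b _.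
by rewrite mul0r oppr0 expr0z mulr1.
Qed.

End Grid.

(** * Counting the solutions *)

(** Each descent yields a point by the intermediate value theorem. It is not the right end of its
    cell, where [f < v], so the points lie in disjoint half-open cells. *)
Lemma descents_crossings (R : realType) (f : R -> R) (h v : R) (N : nat) :
  continuous f -> 0 < h ->
  exists s : seq R, [/\ uniq s, forall t, t \in s -> 0 <= t < N%:R * h,
    forall t, t \in s -> f t = v &
    size s = descents R N (fun a => f (a%:R * h)) v].
Proof.
move=> cf h0; elim: N => [|N [s [us s_itv sv size_s]]].
  by exists [::]; split=> //; rewrite /descents big_nil.
rewrite /descents big_nat_recr //= -/(descents _ _ _ _) -size_s.
have lt1 : N%:R * h < N.+1%:R * h by rewrite ltr_pM2r // ltr_nat.
case: andP => [[fN fN1]|_]; last first.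
  exists s; split=> // [t /s_itv/andP[-> /lt_trans]|]; last by rewrite addn0.
  exact.
have [||c] := @IVT R f (N%:R * h) (N.+1%:R * h) v (ltW lt1).
- by apply: continuous_subspaceT => t; exact: cf.
- rewrite -ltNge in fN1.
  by rewrite ge_min (ltW fN1) orbT le_max fN.
rewrite in_itv /= => /andP[Nc cN] fc; exists (c :: s); split=> [|t|t|].
- by rewrite /= us andbT; apply/negP => /s_itv/andP[_]; rewrite ltNge Nc.
- rewrite inE => /predU1P[->|/s_itv/andP[-> /lt_trans ->//]].
  rewrite (le_trans _ Nc) ?mulr_ge0 ?ler0n ?(ltW h0) //= lt_neqAle cN andbT.
  by apply/eqP => ce; move: fN1; rewrite -ce fc lexx.
- by rewrite inE => /predU1P[->//|/sv].
- by rewrite /= addn1.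
Qed.

(** After taking 25th powers the claim for [k = 1] is [2^9 <= (4/3)^25], which follows from
    [4 <= (4/3)^5] and [2^9 <= 4^5]. *)
Lemma powR2_le_43 (R : realType) k : (2 ^ k)%N%:R `^ (36 / 100) <= (4 / 3) ^+ k :> R.
Proof.
rewrite natrX -powR_mulrn // -powRrM mulrC powRrM powR_mulrn ?powR_ge0 //.
apply: lerXn2r; rewrite ?nnegrE ?powR_ge0 //.
rewrite -(@ler_pXn2r _ 25) ?nnegrE ?powR_ge0 //.
rewrite -powR_mulrn ?powR_ge0 // -powRrM.
have -> : 36 / 100 * 25%:R = 9%:R :> R by field.
rewrite powR_mulrn //.
have h : 4 <= (4 / 3) ^+ 5 :> R by rewrite !exprS expr0; lra.
have := lerXn2r 5 (_ : 4 \is Num.nneg) _ h; rewrite -exprM => /(_ _ _) h2.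
apply: le_trans (h2 _ _); rewrite ?nnegrE ?exprn_ge0 //.
by lra.
Qed.

Lemma stokes_crossings (R : realType) (K : nat) (eta : R) : (0 < K)%N ->
  `|eta| < 2 ^- 11 ->
  at_least_on_circle (1 / 1300 * (2 ^ K)%N%:R `^ (36 / 100))
    [set t : R | (stokes R K t).1.1 = eta].
Proof.
move=> K0 eta_lt; set N := (2 ^ K.+1)%N; set h : R := 2 * pi / N%:R.
have N0 : (0 < N)%N by rewrite expn_gt0.
have NR0 : 0 < N%:R :> R by rewrite ltr0n.
have h0 : 0 < h by rewrite divr_gt0 // mulr_gt0 // pi_gt0.
have [cx _ _] := stokes_continuous R K.
have [s [us s_itv s_eta size_s]] := @descents_crossings R _ h eta N cx h0.
exists s; split=> // [t|].
  by move/s_itv; rewrite /h mulrC divfK ?gt_eqF.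
rewrite size_s; set g := fun a : nat => (stokes R K (a%:R * h)).1.1.
have M0 : 0 < (3 / 4) ^+ K :> R by rewrite exprn_gt0 //; lra.
have NM1 : 1 <= N%:R * (3 / 4) ^+ K :> R.
  rewrite /N expnS natrM natrX -mulrA -exprMn.
  have : 1 <= (2 * (3 / 4)) ^+ K :> R by rewrite exprn_ege1 //; lra.
  by lra.
(* The window bound [N^2 (3/4)^K L] is at most [N L^2 / 64] once [L >= 64 N (3/4)^K]. As
   [N (3/4)^K >= 1], rounding up raises 64 to at most 65. *)
pose L0 := (Num.truncn (64 * (N%:R * (3 / 4) ^+ K) : R)).+1.
have L0gt : 64 * (N%:R * (3 / 4) ^+ K) < L0%:R :> R by rewrite /L0 truncnS_gt.
have L0le : L0%:R <= 65 * (N%:R * (3 / 4) ^+ K) :> R.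
  rewrite /L0 -natr1.
  have : (Num.truncn (64 * (N%:R * (3 / 4) ^+ K) : R))%:R <=
     64 * (N%:R * (3 / 4) ^+ K) :> R by rewrite truncn_le; lra.
  by lra.
pose L := minn N L0.
have LN : (L <= N)%N by rewrite geq_minl.
have L_gt0 : (0 < L)%N by rewrite leq_min N0.
have Lle : L%:R <= 65 * (N%:R * (3 / 4) ^+ K) :> R.
  by apply: le_trans L0le; rewrite ler_nat geq_minr.
have gN a : g (a + N)%N = g a by rewrite /g grid_stokes_periodic.
have g1 a : `|g a| <= 1 by exact: stokes_x_le1.
have eta1 : `|eta| <= 1 / 2048.
  have e : 2 ^+ 11 = 2048 :> R by ring.
  by rewrite e in eta_lt; rewrite div1r ltW.
(* Since [|x| <= 1], the mean of [|x|] is at least that of [x^2]. *)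
have gl1 : N%:R / 4 <= \sum_(0 <= a < N) `|g a|.
  have /andP[le1 _] := grid_sqr_sum_bounds R K K (introT andP (conj K0 (leqnn K))).
  apply: (le_trans le1); rewrite /grid_sqr_sum; apply: ler_sum => a _.
  rewrite -real_normK ?num_real // expr2.
  by apply: ler_piMl; [exact: normr_ge0 | exact: g1].
have gl2 : \sum_(0 <= a < N) window R L g a ^+ 2 <= N%:R * L%:R ^+ 2 / 64.
  have [LE|NL] := leqP N L0.
    rewrite big1 ?divr_ge0 ?mulr_ge0 ?sqr_ge0 ?(ltW NR0) // => a _.
    by rewrite /L (minn_idPl LE) grid_stokes_sum0 expr0n.
  apply: le_trans (grid_stokes_window R K L LN) _.
  have : 64 * (N%:R * (3 / 4) ^+ K) <= L%:R :> R by rewrite /L (minn_idPr (ltnW NL)) ltW.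
  move/(ler_wpM2l (_ : 0 <= N%:R * L%:R :> R)) => /(_ (mulr_ge0 (ltW NR0) (ler0n _ _))).
  by rewrite expr2; move: (_ ^+ K) => M; lra.
have := many_descents R N L g eta gN L_gt0 g1 eta1 gl1 gl2.
move: (descents _ _ _ _) => D NLD.
(* Here [1300 = 20 * 65]. *)
have : N%:R * 1 <= N%:R * (1300 * (3 / 4) ^+ K * D%:R) :> R.
  rewrite mulr1; apply: le_trans NLD _.
  have := ler_wpM2r (ler0n R D) Lle; move: (_ ^+ K) => M; lra.
rewrite ler_pM2l // => D1.
have := powR2_le_43 R K.
have : (4 / 3) ^+ K <= (4 / 3) ^+ K * (1300 * (3 / 4) ^+ K * D%:R) :> R.
  by apply: ler_peMr => //; rewrite exprn_ge0 //; lra.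
have -> : (4 / 3) ^+ K * (1300 * (3 / 4) ^+ K * D%:R) =
    1300 * (4 / 3 * (3 / 4)) ^+ K * D%:R :> R by rewrite [(4 / 3 * (3 / 4)) ^+ K]exprMn; ring.
have -> : 4 / 3 * (3 / 4) = 1 :> R by field.
rewrite expr1n; lra.
Qed.

Theorem theorem2p6 (R : realType) :
  exists A : R, 0 < A /\
    forall (k : nat) (f : {poly R[i]}) (eta : R),
      (0 < k)%N ->
      f = rudin_shapiroP R k \/ f = rudin_shapiroQ R k ->
      `|eta| < 2 ^- 11 ->
      let n : R := (2 ^ k)%N%:R in
      at_least_on_circle (A * n `^ (36 / 100))
        [set t : R | modulus_sq f t = (1 + eta) * n].
Proof.
exists (1 / 1300); split=> [|k f eta k0 fPQ eta_lt n]; first by lra.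
case: fPQ => ->.
  have [s [us s_itv s_eta size_s]] := stokes_crossings R k eta k0 eta_lt.
  by exists s; split=> // t /s_eta /= ht; rewrite modulus_sqP ht mulrC.
(* As [|Q|^2 = n (1 - x)], level [eta] for [Q] is level [- eta] for [x]. *)
have [|s [us s_itv s_eta size_s]] := stokes_crossings R k (- eta) k0; first by rewrite normrN.
by exists s; split=> // t /s_eta /= ht; rewrite modulus_sqQ ht opprK mulrC.
Qed.
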